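(* Let $H:\mathbb{N}\times\mathbb{N}\to\mathbb{N}$ be a numerical function. Then the following are equivalent: (1) $H$ is a Ferrers function; (2) $H=H_{R/I}$ for some bigraded ideal $I\subseteq R$.
   Context: Here $\mathbb{N}=\{0,1,2,\dots\}$, and a numerical function is simply a function with values in $\mathbb{N}$. **Bigraded algebras.** $k$ is an infinite field and $R=k[x_1,x_2,y_1,y_2]$ is the polynomial ring in 4 indeterminates, $\mathbb{N}^2$-graded by $\deg x_1=\deg x_2=(1,0)$ and $\deg y_1=\deg y_2=(0,1)$. $R_{(i,j)}$ denotes the homogeneous component of degree $(i,j)$. An ideal $I\subseteq R$ is bigraded if it is generated by elements homogeneous for this grading; $I_{(i,j)}=I\cap R_{(i,j)}$. The Hilbert function of $R/I$ is $H_{R/I}:\mathbb{N}^2\to\mathbb{N}$, $H_{R/I}(i,j)=\dim_k (R/I)_{(i,j)}=\dim_k R_{(i,j)}-\dim_k I_{(i,j)}$. **Partitions with sides.** For $h,\ell_1,\ell_2\in\mathbb{N}$, a partition of $h$ of sides $(\ell_1,\ell_2)$ is a tuple $\alpha=(p_1,\dots,p_t)\in\mathbb{N}^t$ with $t=\ell_2$, $p_1+\cdots+p_t=h$ and $\ell_1\ge p_1\ge\cdots\ge p_t\ge 0$. Let $\mathcal{S}(h)^{(\ell_1,\ell_2)}$ be the set of these and $\mathcal{S}(\cdot)^{(\ell_1,\ell_2)}=\bigcup_{h\in\mathbb{N}}\mathcal{S}(h)^{(\ell_1,\ell_2)}$. Put $\lambda_1(\alpha)=|\{j : p_j=\ell_1\}|$.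 For $\alpha,\alpha'\in\mathcal{S}(\cdot)^{(\ell_1,\ell_2)}$, $\alpha'\le\alpha$ means that each entry of $\alpha'$ is at most the corresponding entry of $\alpha$. For $\alpha=(p_1,\dots,p_t)\in\mathcal{S}(\cdot)^{(\ell_1,\ell_2)}$ define $\alpha^{(1)}=(p'_1,\dots,p'_t)\in\mathcal{S}(\cdot)^{(\ell_1+1,\ell_2)}$ by $p'_j=p_j+1$ if $j\le\lambda_1(\alpha)$ and $p'_j=p_j$ if $j>\lambda_1(\alpha)$; and define $\alpha^{(2)}=(p_1,\dots,p_{t-1},p_t,p_t)\in\mathcal{S}(\cdot)^{(\ell_1,\ell_2+1)}$ (the last entry is repeated). **Ferrers functions.** A numerical function $H:\mathbb{N}\times\mathbb{N}\to\mathbb{N}$ is a Ferrers function if $H(0,0)=1$ and for every $(i,j)\in\mathbb{N}^2$ there is a partition $\alpha_{ij}\in\mathcal{S}(H(i,j))^{(i+1,j+1)}$ such that all these partitions satisfy $\alpha_{ij}\le\alpha_{i-1\,j}^{(1)}$ whenever $i>0$ and $\alpha_{ij}\le\alpha_{i\,j-1}^{(2)}$ whenever $j>0$.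
   Formalization: The ideal I in (2) is required to be proper: for I = R the Hilbert function is identically 0, so (2) would hold while (1) fails since H(0,0) = 1 is required of a Ferrers function. *)

(* Defs.v *)
From HB Require Import structures.
From mathcomp Require Import all_boot all_order all_algebra.
From mathcomp Require Import boolp classical_sets cardinality.
From mathcomp Require Import mpoly.

Set Implicit Arguments.
Unset Strict Implicit.
Unset Printing Implicit Defensive.

Import GRing.Theory.

Local Open Scope ring_scope.

Definition is_partition (l1 l2 h : nat) (alpha : seq nat) : bool :=
  [&& size alpha == l2, sumn alpha == h, sorted geq alpha
    & all (fun p => p <= l1)%N alpha].

Definition lambda1 (l1 : nat) (alpha : seq nat) : nat := count_mem l1 alpha.

Definition partition_le (alpha' alpha : seq nat) : bool := all2 leq alpha' alpha.

(* [l1] is the first side of [alpha]. Entries are indexed from 0, so the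
   condition on the index is strict. *)
Definition extend1 (l1 : nat) (alpha : seq nat) : seq nat :=
  mkseq (fun j => nth 0 alpha j + (j < lambda1 l1 alpha))%N (size alpha).

Definition extend2 (alpha : seq nat) : seq nat := rcons alpha (last 0%N alpha).

Definition ferrers_function (H : nat -> nat -> nat) : Prop :=
  H 0 0 = 1%N /\
  exists alpha : nat -> nat -> seq nat,
    [/\ forall i j, is_partition i.+1 j.+1 (H i j) (alpha i j),
        forall i j, partition_le (alpha i.+1 j) (extend1 i.+1 (alpha i j))
      & forall i j, partition_le (alpha i j.+1) (extend2 (alpha i j))].

Section Bigraded.
Variable k : fieldType.

(* The indeterminates x_1, x_2, y_1, y_2 are 'X_0, 'X_1, 'X_2, 'X_3. *)
Local Notation R := {mpoly k[4]}.

Definition bidegree (m : 'X_{1..4}) : nat * nat :=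
  (\sum_(a < 4 | a < 2) m a, \sum_(a < 4 | 2 <= a) m a)%N.

Definition bihomog (i j : nat) (p : R) : bool :=
  all (fun m => bidegree m == (i, j)) (msupp p).

Definition ideal_generated_by (I : {pred R}) (G : set R) : Prop :=
  forall p : R, p \in I <->
    exists2 s : seq (R * R),
      (forall c, c \in s -> G c.2) & p = \sum_(c <- s) c.1 * c.2.

(* An [idealr] is by definition a proper ideal; I = R has to be excluded, since
   its Hilbert function vanishes at (0, 0). *)
Definition bigraded (I : idealr R) : Prop :=
  exists2 G : set R,
    (forall g, G g -> exists i j, bihomog i j g) & ideal_generated_by I G.

(* A form of bidegree (i, j) is homogeneous of total degree i + j, so the
   bigraded pieces are subspaces of the finite-dimensional space
   [dhomog 4 k (i + j)]. *)
Definition ambient_piece (i j : nat) : {pred dhomog 4 k (i + j)} :=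
  [pred p : dhomog 4 k (i + j) | bihomog i j p].

Definition ideal_piece (I : idealr R) (i j : nat) : {pred dhomog 4 k (i + j)} :=
  [pred p : dhomog 4 k (i + j) | bihomog i j p && ((p : R) \in I)].

Lemma ex_vspace (vT : vectType k) (S : {pred vT}) :
  submod_closed S -> exists U : {vspace vT}, U =i S.
Proof.
move=> [S0 SD].
have SZ c v : v \in S -> c *: v \in S.
  by move=> Sv; rewrite -[_ *: _]addr0 SD.
have Sadd u v : u \in S -> v \in S -> u + v \in S.
  by move=> Su Sv; rewrite -[u]scale1r SD.
pose P d := `[< exists2 U : {vspace vT}, {subset U <= S} & \dim U = d >].
have P0 : exists d, P d.
  exists 0%N; apply/asboolP; exists 0%VS; last exact: dimv0.
  by move=> v; rewrite memv0 => /eqP->.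
have Pb d : P d -> (d <= \dim {:vT})%N.
  by move=> /asboolP[U _ <-]; apply/dimvS/subvf.
case: (ex_maxnP P0 Pb) => d /asboolP[U US dU] dmax.
exists U => v; apply/idP/idP => [/US//|Sv].
have US' : {subset (U + <[v]>)%VS <= S}.
  move=> w /memv_addP[u Uu [_ /vlineP[c ->] ->]].
  by apply: Sadd; [exact: US|exact: SZ].
have /dmax : P (\dim (U + <[v]>)%VS) by apply/asboolP; exists (U + <[v]>)%VS.
rewrite -dU => le_d.
have /eqP -> : U == (U + <[v]>)%VS by rewrite eqEdim addvSl.
by apply/(subvP (addvSr _ _))/memv_line.
Qed.

Lemma bihomogP i j (p : R) :
  reflect (forall m, bidegree m != (i, j) -> p@_m = 0) (bihomog i j p).
Proof.
apply: (iffP allP) => [h m|h m].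
  by apply: contraNeq; rewrite -mcoeff_msupp => /h.
by rewrite mcoeff_msupp; apply: contraNT => /h ->.
Qed.

Lemma ambient_piece_submod i j : submod_closed (@ambient_piece i j).
Proof.
split=> [|c p q]; rewrite !inE.
  by apply/bihomogP => m _ /=; rewrite mcoeff0.
move=> /bihomogP hp /bihomogP hq; apply/bihomogP => m hm /=.
by rewrite linearP /= hp // hq // mulr0 addr0.
Qed.

Lemma ideal_piece_submod (I : idealr R) i j : submod_closed (@ideal_piece I i j).
Proof.
have [S0 SD] := ambient_piece_submod i j.
split=> [|c p q]; rewrite !inE.
  by apply/andP; split; [exact: S0|rewrite linear0 rpred0].
move=> /andP[hp Ip] /andP[hq Iq]; apply/andP; split; first exact: SD.
have -> : ((c *: p + q : dhomog 4 k (i + j)) : R) = c%:MP * (p : R) + (q : R).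
  by rewrite mul_mpolyC linearP.
by rewrite rpredD // idealMr.
Qed.

Definition ambient_space i j : {vspace dhomog 4 k (i + j)} :=
  sval (cid (ex_vspace (ambient_piece_submod i j))).

Definition ideal_space (I : idealr R) i j : {vspace dhomog 4 k (i + j)} :=
  sval (cid (ex_vspace (ideal_piece_submod I i j))).

Lemma ambient_spaceE i j : ambient_space i j =i @ambient_piece i j.
Proof. by rewrite /ambient_space; case: cid. Qed.

Lemma ideal_spaceE (I : idealr R) i j : ideal_space I i j =i @ideal_piece I i j.
Proof. by rewrite /ideal_space; case: cid. Qed.

Definition hilbert_function (I : idealr R) (i j : nat) : nat :=
  (\dim (ambient_space i j) - \dim (ideal_space I i j))%N.

End Bigraded.

(* Main.v *)
From HB Require Import structures.
Require Import Defs.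
From mathcomp Require Import all_boot all_order all_algebra.
From mathcomp Require Import boolp classical_sets cardinality.
From mathcomp Require Import mpoly zify.

(** Hilbert functions of bigraded ideals and Ferrers functions are two
descriptions of one combinatorial object: an order ideal [D] of monomials,
that is, a set of monomials containing 1 and closed under divisors, counted
in each bidegree.

From ideals to order ideals, the monomials of bidegree (i, j) that are not
leading monomials of a form of [I] of that bidegree are the standard
monomials. They form an order ideal because leading monomials are
multiplicative, and they are counted by the Hilbert function because the
dimension of a space of polynomials is the number of its leading monomials
([dim_leads], [hilbert_function_standard]). Conversely the polynomials with
no monomial in [D] form a bigraded ideal whose standard monomials are exactly
those of [D] ([standard_monomial_ideal]).

From Ferrers functions to order ideals, one puts x_1^a x_2^(i-a) y_1^b
y_2^(j-b) in [D] when a is less than the entry of index b of the partition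
[alpha i j], so that each partition is the Young diagram of a bidegree of [D].
The two Ferrers inequalities are what closure under division by the
indeterminates needs.

In the other direction, let the rows of [D] in bidegree (i, j) count its
monomials with a given exponent b of y_1. The rows need not decrease with b:
the usual way to force this is to pass to a generic initial ideal, which in
characteristic p need not be stable under replacing y_2 by y_1. It is enough
to sort the rows. Sorting preserves the Ferrers inequalities since an entry of
a sorted sequence is determined by the number of entries above each threshold
([leq_nth_sorted]), and those numbers are controlled by one elementary fact,
the case of Macaulay's theorem in two variables: if a set B of indices in
{0, ..., n} is not empty, the union of B and B + 1 has more elements than B
([count_iota_shift], stated for complements). It is used once in the x
direction, to compare a row with the same row in bidegree (i+1, j), and once
in the y direction, to compare the sets of rows below a threshold in
bidegrees (i, j) and (i, j+1). *)

Set Implicit Arguments.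
Unset Strict Implicit.
Unset Printing Implicit Defensive.

Import Order.TTheory GRing.Theory.

Local Open Scope nat_scope.

(** * Decreasing sequences and counting *)

Lemma geq_trans : transitive geq.
Proof. by move=> m n p nm pm; exact: leq_trans pm nm. Qed.

Lemma geq_total : total geq.
Proof. by move=> m n; exact: leq_total. Qed.

Lemma sorted_geq_nth (s : seq nat) : sorted geq s ->
  {homo nth 0 s : q r / q <= r >-> r <= q}.
Proof.
move=> s_sorted q r le_qr.
have [lt_rs|] := ltnP r (size s); last by move/(nth_default 0)->.
apply: (sorted_leq_nth geq_trans leqnn 0 s_sorted) => //.
by rewrite inE (leq_ltn_trans le_qr).
Qed.

(** Reduces an entrywise comparison of two sorted sequences to the comparison,
for each threshold [c], of how many entries reach [c]; the latter does not see
the order of the entries, so it can be checked before sorting. *)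
Lemma leq_nth_sorted (s : seq nat) c r : sorted geq s -> r < size s ->
  (c <= nth 0 s r) = (r < count (leq c) s).
Proof.
elim: s r => // x s IHs r x_s lt_r.
have s_sorted := path_sorted x_s.
have [le_cx|lt_xc] := leqP c x.
  by case: r lt_r => [|r] lt_r /=; rewrite le_cx //= add1n ltnS IHs.
have lt_all y : y \in x :: s -> leq c y = pred0 y.
  rewrite inE leqNgt => /predU1P[->|s_y]; first by rewrite lt_xc.
  have /allP/(_ _ s_y) /= le_yx := order_path_min geq_trans x_s.
  by rewrite (leq_ltn_trans le_yx).
by rewrite (eq_in_count lt_all) count_pred0 lt_all ?mem_nth.
Qed.

Lemma partition_leP s t : size s = size t ->
  (forall r, r < size s -> nth 0 s r <= nth 0 t r) -> partition_le s t.
Proof.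
move=> eq_st le_st; rewrite /partition_le all2E eq_st eqxx /=.
apply/(all_nthP (0, 0)) => r; rewrite size_zip -eq_st minnn => lt_r.
by rewrite /= nth_zip //= le_st.
Qed.

Lemma partition_le_nth s t : partition_le s t ->
  forall r, nth 0 s r <= nth 0 t r.
Proof.
elim: s t => [|x s IHs] [|y t] //= /andP[le_xy /IHs le_st] [|r] //=.
Qed.

(** Macaulay's bound in two variables, read on complements: the part of
{0, ..., n+1} outside [B] contains the part of {0, ..., n} outside [A] and its
translate by one. Take [m] in the latter; below [m] the elements of [B] inject
into [A] as they are, above [m + 1] they inject after a translation by -1, and
neither [m] nor [m + 1] is in [B]. *)
Lemma count_iota_shift (A B : pred nat) n m :
    (forall a, a <= n -> B a -> A a) -> (forall a, a <= n -> B a.+1 -> A a) ->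
    m <= n -> ~~ A m ->
  count B (iota 0 n.+2) <= count A (iota 0 n.+1).
Proof.
move=> BA BSA le_mn nAm.
have -> : n.+2 = m + (2 + (n - m)) by lia.
have -> : n.+1 = m + (1 + (n - m)) by lia.
rewrite !(iotaD _ _ (_ + _)) !(iotaD _ _ (n - m)) !count_cat !add0n.
apply: leq_add.
  rewrite -!size_filter; apply: uniq_leq_size; first exact/filter_uniq/iota_uniq.
  move=> a; rewrite !mem_filter mem_iota => /andP[Ba lt_am].
  by rewrite lt_am BA //; lia.
have nBm : B m = false by apply: contraNF nAm; exact: BA.
have nBSm : B m.+1 = false by apply: contraNF nAm; exact: BSA.
rewrite /= nBm nBSm (negbTE nAm) !add0n ?addn0.
have -> : m + 2 = 1 + (m + 1) by lia.
rewrite iotaDl count_map -!size_filter.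
apply: uniq_leq_size; first exact/filter_uniq/iota_uniq.
move=> a; rewrite !mem_filter mem_iota /= => /andP[Ba lt_a].
by rewrite lt_a BSA //; lia.
Qed.

(** * Monomials of a given bidegree *)

Local Notation "'i0" := (@Ordinal 4 0 isT).
Local Notation "'i1" := (@Ordinal 4 1 isT).
Local Notation "'i2" := (@Ordinal 4 2 isT).
Local Notation "'i3" := (@Ordinal 4 3 isT).

(** The monomial x_1^a x_2^a' y_1^b y_2^b'. *)
Definition bimon (a a' b b' : nat) : 'X_{1..4} :=
  [multinom [tuple a; a'; b; b']].

Lemma ord4_ind (P : 'I_4 -> Prop) :
  P 'i0 -> P 'i1 -> P 'i2 -> P 'i3 -> forall e, P e.
Proof.
move=> P0 P1 P2 P3 [[|[|[|[|//]]]] lt_e]; rewrite (bool_irrelevance lt_e isT) //.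
Qed.

Lemma bimonK (m : 'X_{1..4}) : bimon (m 'i0) (m 'i1) (m 'i2) (m 'i3) = m.
Proof. by apply/mnmP; elim/ord4_ind; rewrite multinomE. Qed.

Lemma bimon0 : bimon 0 0 0 0 = 0%MM.
Proof. by apply/mnmP; elim/ord4_ind; rewrite mnm0E multinomE. Qed.

Lemma bimonS : [/\
  forall a a' b b', (bimon a a' b b' + U_('i0))%MM = bimon a.+1 a' b b',
  forall a a' b b', (bimon a a' b b' + U_('i1))%MM = bimon a a'.+1 b b',
  forall a a' b b', (bimon a a' b b' + U_('i2))%MM = bimon a a' b.+1 b'
& forall a a' b b', (bimon a a' b b' + U_('i3))%MM = bimon a a' b b'.+1].
Proof.
by split=> a a' b b'; apply/mnmP; elim/ord4_ind;
  rewrite mnmDE mnm1E !multinomE /= /tnth /= ?addn0 ?addn1.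
Qed.

(** The exponent [b] of y_1 varies in the outer loop, so that the list is the
concatenation of the rows of the bidegree. *)
Definition bimons (i j : nat) : seq 'X_{1..4} :=
  [seq bimon a (i - a) b (j - b) | b <- iota 0 j.+1, a <- iota 0 i.+1].

Lemma bidegreeE (m : 'X_{1..4}) : bidegree m = (m 'i0 + m 'i1, m 'i2 + m 'i3).
Proof.
congr (_, _); rewrite big_mkcond !big_ord_recl big_ord0 /= !(add0n, addn0);
  by congr (_ + _); congr (m _); apply: val_inj.
Qed.

Lemma mem_bimons i j m : (m \in bimons i j) = (bidegree m == (i, j)).
Proof.
rewrite bidegreeE; apply/allpairsP/eqP => [[[b a] [+ + ->]]|[<- <-]].
  rewrite !mem_iota !multinomE /tnth /= => lt_b lt_a.
  by congr (_, _); lia.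
exists (m 'i2, m 'i0); rewrite !mem_iota /= !addKn bimonK.
by split=> //; lia.
Qed.

Lemma bimons_uniq i j : uniq (bimons i j).
Proof.
apply: allpairs_uniq; try exact: iota_uniq.
move=> [b a] [d c] _ _ /= /mnmP eq_m; move: (eq_m 'i0) (eq_m 'i2).
by rewrite !multinomE /tnth /= => -> ->.
Qed.

(** * The partitions of an order ideal *)

Definition order_ideal (D : pred 'X_{1..4}) : Prop :=
  D 0%MM /\ forall m e, D (m + U_(e))%MM -> D m.

Section Rows.
Variable D : pred 'X_{1..4}.

Definition row i j b : nat :=
  count (fun a => D (bimon a (i - a) b (j - b))) (iota 0 i.+1).

Definition rows i j : seq nat := [seq row i j b | b <- iota 0 j.+1].

Lemma size_rows i j : size (rows i j) = j.+1.
Proof. by rewrite size_map size_iota. Qed.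

Lemma row_le i j b : row i j b <= i.+1.
Proof. by rewrite (leq_trans (count_size _ _)) ?size_iota. Qed.

Lemma count_bimons i j : count D (bimons i j) = sumn (rows i j).
Proof.
rewrite count_flatten -map_comp; congr sumn; apply: eq_map => b.
exact: count_map.
Qed.

Hypothesis D_ideal : order_ideal D.

(** Multiplication by x_2 keeps the index of a monomial in its row and
multiplication by x_1 adds one to it, which is the situation of
[count_iota_shift]. *)
Lemma row_shift1 i j b : row i j b <= i -> row i.+1 j b <= row i j b.
Proof.
have [_ DU] := D_ideal; have [S0 S1 _ _] := bimonS.
move=> lt_row; pose A a := D (bimon a (i - a) b (j - b)).
(* The row is not full, so some index is missing from it. *)
have /allPn[m] : ~~ all A (iota 0 i.+1).
  by rewrite all_count size_iota -/(row i j b); lia.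
rewrite mem_iota => lt_m nAm.
apply: (@count_iota_shift A _ _ m) => // a le_ai; rewrite /A.
  by rewrite subSn // -S1; exact: DU.
by rewrite subSS -S0; exact: DU.
Qed.

Lemma row_shift2 i j b : b <= j -> row i j.+1 b <= row i j b.
Proof.
have [_ DU] := D_ideal; have [_ _ _ S3] := bimonS.
by move=> le_bj; apply: sub_count => a /=; rewrite subSn // -S3; exact: DU.
Qed.

Lemma row_shift2S i j b : row i j.+1 b.+1 <= row i j b.
Proof.
have [_ DU] := D_ideal; have [_ _ S2 _] := bimonS.
by apply: sub_count => a /=; rewrite subSS -S2; exact: DU.
Qed.

(** The rows are not decreasing in general: the complement of the multiples of
y_1^2 and y_2^2 has rows 0, 1, 0 in bidegree (0, 2). *)
Definition profile i j : seq nat := sort geq (rows i j).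

Lemma profile_sorted i j : sorted geq (profile i j).
Proof. exact: (sort_sorted geq_total). Qed.

Lemma size_profile i j : size (profile i j) = j.+1.
Proof. by rewrite size_sort size_rows. Qed.

Lemma leq_nth_profile c i j r : r <= j ->
  (c <= nth 0 (profile i j) r) = (r < count (fun b => c <= row i j b) (iota 0 j.+1)).
Proof.
move=> le_rj; rewrite leq_nth_sorted ?size_profile ?profile_sorted //.
by rewrite count_sort count_map.
Qed.

Lemma profile_partition i j :
  is_partition i.+1 j.+1 (count D (bimons i j)) (profile i j).
Proof.
rewrite /is_partition size_profile profile_sorted eqxx /=.
have perm_s : perm_eq (profile i j) (rows i j) by rewrite perm_sort.
rewrite (perm_sumn perm_s) -count_bimons eqxx /= (perm_all _ perm_s).
by apply/allP => _ /mapP[b _ ->]; exact: row_le.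
Qed.

(** From (i, j) to (i+1, j), a row that is not full does not grow and a full one
grows by at most one. So the entries of the new sorted sequence that exceed
[i.+1] are no more numerous than the old full rows, counted by [lambda1]. *)
Lemma profile_extend1 i j :
  partition_le (profile i.+1 j) (extend1 i.+1 (profile i j)).
Proof.
apply: partition_leP => [|r]; first by rewrite size_mkseq !size_profile.
rewrite size_profile => lt_rj; rewrite nth_mkseq ?size_profile //.
set c := nth 0 _ _.
have : r < count (fun b => c <= row i.+1 j b) (iota 0 j.+1).
  by rewrite -leq_nth_profile.
have row_cases b : row i.+1 j b <= row i j b \/
    row i j b = i.+1 /\ row i.+1 j b <= i.+2.
  have := row_le i j b; rewrite leq_eqVlt => /predU1P[->|lt_row].
    by right; rewrite row_le.
  by left; apply: row_shift1.
have [le_c|lt_c] := leqP c i.+1.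
  (* A full row also reaches [c], so the entries reaching [c] do not become
     more numerous. *)
  move=> lt_r; apply: leq_trans (leq_addr _ _).
  rewrite leq_nth_profile //; apply: leq_trans lt_r _.
  by apply: sub_count => b /= le_cp; case: (row_cases b); lia.
move=> lt_r.
(* Only the rows that were full in bidegree (i, j) reach [c]. *)
have -> : r < lambda1 i.+1 (profile i j).
  rewrite /lambda1 count_sort count_map; apply: leq_trans lt_r _.
  by apply: sub_count => b /= le_cp; case: (row_cases b); have := row_le i j b; lia.
have le_c2 : c <= i.+2.
  have /hasP[b _ le_cp] : has (fun b => c <= row i.+1 j b) (iota 0 j.+1).
    by rewrite has_count; lia.
  by apply: leq_trans le_cp (row_le _ _ _).
suff : i.+1 <= nth 0 (profile i j) r by lia.
rewrite leq_nth_profile //; apply: leq_trans lt_r _.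
by apply: sub_count => b /= le_cp; case: (row_cases b); lia.
Qed.

(** If a row of bidegree (i, j) is below the threshold [c], the rows below [c]
are more numerous in bidegree (i, j+1), since multiplication by y_2 keeps the
index of a row and multiplication by y_1 adds one to it. Otherwise all the
entries of [profile i j] reach [c], in particular the last one, which
[extend2] repeats. *)
Lemma profile_extend2 i j :
  partition_le (profile i j.+1) (extend2 (profile i j)).
Proof.
apply: partition_leP => [|r]; first by rewrite size_rcons !size_profile.
rewrite size_profile => lt_r; set c := nth 0 _ _.
have : r < count (fun b => c <= row i j.+1 b) (iota 0 j.+2).
  by rewrite -leq_nth_profile.
rewrite /extend2 nth_rcons size_profile -nth_last size_profile /=.
pose A b := c <= row i j b.
have [/all_filterP|/allPn[m]] := boolP (all A (iota 0 j.+1)).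
  move/(congr1 size); rewrite size_filter size_iota => A_all _.
  by case: ifP => lt_rj; rewrite ?ifT ?leq_nth_profile -/(A _) ?A_all //; lia.
rewrite mem_iota => lt_m nAm lt_r2.
have lt_rA : r < count A (iota 0 j.+1).
  apply: leq_trans lt_r2 _; apply: (@count_iota_shift _ _ _ m) => // b le_bj.
    by move/leq_trans; apply; exact: row_shift2.
  by move/leq_trans; apply; exact: row_shift2S.
have lt_rj : r < j.+1.
  by apply: leq_trans lt_rA _; rewrite -[leqRHS](size_iota 0) count_size.
by rewrite lt_rj leq_nth_profile.
Qed.

End Rows.

(** * The order ideal of a table of partitions *)

Section Table.
Variables (H : nat -> nat -> nat) (alpha : nat -> nat -> seq nat).
Hypothesis alpha_part : forall i j, is_partition i.+1 j.+1 (H i j) (alpha i j).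
Hypothesis alpha1 :
  forall i j, partition_le (alpha i.+1 j) (extend1 i.+1 (alpha i j)).
Hypothesis alpha2 : forall i j, partition_le (alpha i j.+1) (extend2 (alpha i j)).

(** The diagram of [alpha i j] is drawn in bidegree (i, j) with the exponents of
x_1 and y_1 as coordinates. *)
Definition in_diagram (m : 'X_{1..4}) : bool :=
  m 'i0 < nth 0 (alpha (m 'i0 + m 'i1) (m 'i2 + m 'i3)) (m 'i2).

(** [extend1] only lengthens full rows, and these already contain every
[c <= i]. *)
Lemma lt_nth_extend1 i j b c : b <= j -> c <= i ->
  c < nth 0 (extend1 i.+1 (alpha i j)) b -> c < nth 0 (alpha i j) b.
Proof.
have /and4P[/eqP sz _ srt _] := alpha_part i j.
move=> le_bj le_ci; rewrite nth_mkseq ?sz //.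
case: (ltnP b) => [lt_b _|_]; last by rewrite addn0.
rewrite leq_nth_sorted ?sz //; apply: leq_trans lt_b _.
by apply: sub_count => x /= /eqP->.
Qed.

Lemma count_in_diagram i j : count in_diagram (bimons i j) = H i j.
Proof.
have /and4P[/eqP sz /eqP sum_a _ /allP le_a] := alpha_part i j.
rewrite count_bimons -sum_a -[alpha i j in RHS](mkseq_nth 0) sz /mkseq.
congr sumn; apply/eq_in_map => b; rewrite mem_iota => lt_b.
rewrite /row; set p := nth 0 _ b.
have le_p : p <= i.+1 by apply/le_a/mem_nth; rewrite sz.
transitivity (count (fun a => a < p) (iota 0 i.+1)).
  apply: eq_in_count => a; rewrite mem_iota => lt_a.
  by rewrite /in_diagram !multinomE /tnth /= !subnKC //; lia.
have -> : i.+1 = p + (i.+1 - p) by lia.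
rewrite iotaD count_cat -[RHS]addn0; congr (_ + _).
  rewrite -[RHS](size_iota 0); apply/eqP; rewrite -all_count.
  by apply/allP => a; rewrite mem_iota.
apply/eqP; rewrite -leqn0 leqNgt -has_count; apply/hasPn => a.
by rewrite mem_iota; lia.
Qed.

Lemma in_diagram_ideal : H 0 0 = 1 -> order_ideal in_diagram.
Proof.
move=> H00; split=> [|m e].
  have := count_in_diagram 0 0; rewrite H00 /= addn0 => /eqP.
  rewrite /bimons /= eqb1.
  by rewrite bimon0.
have [S0 S1 S2 S3] := bimonS; rewrite -(bimonK m).
move: (m 'i0) (m 'i1) (m 'i2) (m 'i3) => a a' b b'; elim/ord4_ind: e.
- rewrite S0 /in_diagram !multinomE /tnth /= addSn => /ltnW lt_a.
  apply: lt_nth_extend1 (leq_addr _ _) (leq_addr _ _) _.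
  exact: leq_trans lt_a (partition_le_nth (alpha1 _ _) _).
- rewrite S1 /in_diagram !multinomE /tnth /= addnS => lt_a.
  apply: lt_nth_extend1 (leq_addr _ _) (leq_addr _ _) _.
  exact: leq_trans lt_a (partition_le_nth (alpha1 _ _) _).
- rewrite S2 /in_diagram !multinomE /tnth /= addSn.
  have /and4P[/eqP sz _ srt _] := alpha_part (a + a') (b + b').
  move/leq_trans/(_ (partition_le_nth (alpha2 _ _) _))/leq_trans; apply.
  rewrite /extend2 nth_rcons sz -nth_last sz /=.
  case: ltnP => [_|le_b]; first exact: sorted_geq_nth.
  by rewrite ifT; [apply: sorted_geq_nth; rewrite ?leq_addr|lia].
- rewrite S3 /in_diagram !multinomE /tnth /= addnS.
  have /and4P[/eqP sz _ _ _] := alpha_part (a + a') (b + b').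
  move/leq_trans/(_ (partition_le_nth (alpha2 _ _) _)).
  by rewrite /extend2 nth_rcons sz ltnS leq_addr.
Qed.

End Table.

(** The combinatorial half of the theorem: what remains is to compare ideals
with order ideals of monomials, as in Macaulay's theorem. *)
Lemma ferrers_order_ideal (H : nat -> nat -> nat) :
  ferrers_function H <->
  exists2 D, order_ideal D & forall i j, H i j = count D (bimons i j).
Proof.
split=> [[H00 [alpha [part ext1 ext2]]]|[D D_ideal HE]].
  exists (in_diagram alpha); first exact: in_diagram_ideal H00.
  by move=> i j; rewrite (count_in_diagram part).
split.
  rewrite HE /= addn0; apply/eqP; rewrite eqb1.
  by rewrite bimon0; case: D_ideal.
exists (profile D); split=> i j; [|exact: profile_extend1|exact: profile_extend2].
by rewrite HE; exact: profile_partition.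
Qed.

(** * Leading monomials and dimensions *)

Local Open Scope ring_scope.

Section LeadingMonomials.
Variables (k : fieldType) (n d : nat).
Local Notation V := (dhomog n.+1 k d).

Definition is_lead (U : {vspace V}) (m : 'X_{1..n.+1}) : Prop :=
  exists2 v : V, v \in U /\ v != 0 & mlead v = m.

(** The codomain is the field seen as a vector space over itself, for the rank
formula to apply. *)
Definition coeff_at (m : 'X_{1..n.+1}) (v : V) : k^o := (v : {mpoly k[n.+1]})@_m.

Lemma coeff_at_linear m : linear (coeff_at m).
Proof. by move=> c u v; rewrite /coeff_at linearP. Qed.

HB.instance Definition _ m :=
  GRing.isLinear.Build k V k^o _ (coeff_at m) (coeff_at_linear m).

(** Induction on the leading monomials in decreasing order: if [m] is the largest,
the coefficient at [m] is a nonzero linear form on [U], whose kernel has the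
remaining leading monomials. *)
Lemma dim_leads (U : {vspace V}) (L : seq 'X_{1..n.+1}) :
  uniq L -> (forall m, m \in L <-> is_lead U m) -> \dim U = size L.
Proof.
move=> L_uniq; rewrite -(size_sort <=%O) -size_rev => L_leads.
have {L_leads} : forall m, m \in rev (sort <=%O L) <-> is_lead U m.
  by move=> m; rewrite mem_rev mem_sort; exact: L_leads.
have : sorted (fun m m' => m' < m)%O (rev (sort <=%O L)).
  by rewrite rev_sorted sort_lt_sorted.
elim: (rev _) U => [|m s IHs] U m_s leadsP /=.
  apply/eqP; rewrite dimv_eq0; apply/negPn/negP => U_neq0.
  suff /leadsP : is_lead U (mlead (vpick U)) by [].
  by exists (vpick U) => //; rewrite memv_pick vpick0.
have /allP lt_m := order_path_min (rev_trans lt_trans) m_s.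
pose f := linfun (coeff_at m).
have fE v : f v = (v : {mpoly k[n.+1]})@_m by rewrite lfunE.
rewrite -(limg_ker_dim f U) (IHs (U :&: lker f)%VS (path_sorted m_s)).
  rewrite addnC -[RHS]add1n; congr (_ + _)%N; apply/eqP; rewrite eqn_leq.
  rewrite (leq_trans (dimvS (subvf _))) ?dimvf // lt0n dimv_eq0.
  have /leadsP[v [Uv v_neq0] lead_v] := mem_head m s.
  apply: contraNneq v_neq0 => fU0.
  have : f v \in (f @: U)%VS by exact: memv_img.
  by rewrite fU0 memv0 fE -lead_v mleadc_eq0.
move=> m'; split=> [s_m'|].
  have /leadsP[v [Uv v_neq0] lead_v] : m' \in m :: s by rewrite inE s_m' orbT.
  exists v => //; split=> //; rewrite memv_cap Uv memv_ker fE /=.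
  by rewrite mcoeff_gt_mlead // lead_v lt_m.
move=> [v [+ v_neq0] lead_v]; rewrite memv_cap memv_ker fE => /andP[Uv v_m].
have /leadsP : is_lead U m' by exists v.
rewrite inE => /predU1P[eq_m|//]; case/negP: v_neq0.
by move: v_m; rewrite -eq_m -lead_v mleadc_eq0.
Qed.

End LeadingMonomials.

(** * Standard monomials and the Hilbert function *)

Section Hilbert.
Variable k : fieldType.
Local Notation R := {mpoly k[4]}.

Lemma bihomog_dhomog i j (p : R) : bihomog i j p -> p \is (i + j)%N.-homog.
Proof.
move=> /allP p_hom; rewrite dhomogE; apply/allP => m /p_hom.
rewrite bidegreeE => /eqP[<- <-]; rewrite inE /= mdegE !big_ord_recl big_ord0.
by rewrite addn0 !addnA; apply/eqP; congr (m _ + m _ + m _ + m _)%N;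
  apply: val_inj.
Qed.

Lemma mpolyX_neq0 m : 'X_[m] != 0 :> R.
Proof. by rewrite -msupp_eq0 msuppX. Qed.

Lemma bihomogX i j m : bidegree m = (i, j) -> bihomog i j ('X_[m] : R).
Proof. by move=> hm; rewrite /bihomog msuppX /= hm eqxx. Qed.

Lemma bihomogM i j i' j' (p q : R) : bihomog i j p -> bihomog i' j' q ->
  bihomog (i + i')%N (j + j')%N (p * q).
Proof.
move=> /allP hp /allP hq; apply/allP => m /msuppM_le/allpairsP[[m1 m2] /=].
case=> /hp + /hq + ->; rewrite !bidegreeE !mnmDE => /eqP[<- <-] /eqP[<- <-].
by apply/eqP; congr (_, _); rewrite addnACA.
Qed.

(** Leading monomials are taken among the forms of the bidegree of [m], because
the Hilbert function sees [I] one bidegree at a time. *)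
Definition standard (I : {pred R}) (m : 'X_{1..4}) : bool :=
  ~~ `[< exists p : R, [/\ p \in I, bihomog (bidegree m).1 (bidegree m).2 p,
                          p != 0 & mlead p = m] >].

Lemma hilbert_function_standard (I : idealr R) i j :
  hilbert_function I i j = count (standard I) (bimons i j).
Proof.
have bihomog_lead (p : R) m : bihomog i j p -> p != 0 -> mlead p = m ->
    bidegree m = (i, j).
  by move=> /allP p_hom p_neq0 <-; apply/eqP/p_hom/mlead_supp.
have dim_ambient : \dim (ambient_space k i j) = size (bimons i j).
  apply: dim_leads (bimons_uniq i j) _ => m; rewrite mem_bimons; split.
    move=> /eqP/bihomogX X_hom; exists (DHomog (bihomog_dhomog X_hom)).
      by rewrite ambient_spaceE inE X_hom -(inj_eq val_inj) /= mpolyX_neq0.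
    exact: mleadXm.
  case=> v [+ v_neq0]; rewrite ambient_spaceE inE => v_hom lead_v.
  by apply/eqP/(bihomog_lead v).
have dim_ideal : \dim (ideal_space I i j) =
    size [seq m <- bimons i j | ~~ standard I m].
  apply: dim_leads => [|m]; first exact/filter_uniq/bimons_uniq.
  rewrite mem_filter negbK mem_bimons; split.
    move=> /andP[/asboolP[p [Ip + p_neq0 lead_p]] /eqP hm]; rewrite hm => p_hom.
    exists (DHomog (bihomog_dhomog p_hom)) => //.
    by rewrite ideal_spaceE inE p_hom.
  case=> v [+ v_neq0]; rewrite ideal_spaceE inE => /andP[v_hom Iv] lead_v.
  have hm := bihomog_lead v m v_hom v_neq0 lead_v.
  by rewrite hm eqxx andbT; apply/asboolP; exists v.
rewrite /hilbert_function dim_ambient dim_ideal size_filter.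
by rewrite -(count_predC (standard I)) addnK.
Qed.

(** The monomial 1 is standard because a nonzero form of bidegree (0, 0) is a unit
and [I] is proper; closure under divisors holds because leading monomials are
multiplicative. *)
Lemma standard_ideal (I : idealr R) : order_ideal (standard I).
Proof.
split=> [|m e].
  apply/asboolPn => -[p []].
  rewrite bidegreeE !mnm0E /= => Ip /bihomog_dhomog/dhomogP p_hom p_neq0 _.
  have pC : p = (p@_0%MM)%:MP.
    apply/mpolyP => m; rewrite mcoeffC.
    case: eqVneq => [<-|m_neq0]; rewrite ?mulr1 // mulr0.
    apply/memN_msupp_eq0; apply: contra m_neq0 => /p_hom/eqP.
    by rewrite mdeg_eq0 eq_sym.
  have p0_neq0 : (p@_0%MM != 0).
    by apply: contraNneq p_neq0 => p0; rewrite pC p0 mpolyC0.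
  suff : (1 : R) \in I by rewrite idealr1.
  have -> : (1 : R) = ((p@_0%MM)^-1%:MP * p).
    by rewrite {2}pC -mpolyCM mulVf.
  exact: idealMr.
apply: contraNN => /asboolP[p [Ip p_hom p_neq0 lead_p]]; apply/asboolP.
exists ('X_[U_(e)] * p); split; first exact: idealMr.
- have := bihomogM (bihomogX (surjective_pairing (bidegree U_(e)))) p_hom.
  rewrite !bidegreeE /= !mnmDE; congr (bihomog _ _ _); lia.
- by rewrite mulf_neq0 ?mpolyX_neq0.
- by rewrite mleadM ?mpolyX_neq0 // mleadXm lead_p addmC.
Qed.

(** * The monomial ideal of an order ideal *)

Section MonomialIdeal.
Variable D : pred 'X_{1..4}.

Definition monomial_ideal : pred R := [pred p | ~~ has D (msupp p)].

Lemma monomial_idealP (p : R) :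
  reflect (forall m, D m -> p@_m = 0) (p \in monomial_ideal).
Proof.
apply: (iffP hasPn) => h m.
  by move=> Dm; apply/memN_msupp_eq0; apply/negP => /h /negP.
by rewrite mcoeff_msupp; apply: contraNN => /h ->.
Qed.

Hypothesis D_ideal : order_ideal D.

Lemma order_idealD m m' : D (m + m')%MM -> D m'.
Proof.
have [_ DU] := D_ideal; rewrite [m]multinomUE_id addmC.
pose closed n := forall m, D (m + n)%MM -> D m.
have closed0 : closed 0%MM by move=> m1; rewrite addm0.
have closedD n1 n2 : closed n1 -> closed n2 -> closed (n1 + n2)%MM.
  by move=> c1 c2 m1; rewrite addmA => /c2 /c1.
suff : closed (\sum_i U_(i) *+ m i)%MM by apply.
elim/big_ind: _ => // i _; elim: (m i) => [|l IHl]; first by rewrite mulm0n.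
by rewrite mulmS; apply: closedD => // m1; exact: DU.
Qed.

Lemma monomial_ideal_closed : idealr_closed monomial_ideal.
Proof.
split; first by apply/monomial_idealP => m _; rewrite mcoeff0.
  rewrite inE negbK msupp1 /= orbF; by case: D_ideal.
move=> a u v /hasPn Iu /monomial_idealP Iv; apply/monomial_idealP => m Dm.
rewrite mcoeffD Iv // addr0; apply/memN_msupp_eq0; apply/negP.
move=> /msuppM_le/allpairsP[[m1 m2] /= [_ /Iu/negP + mE]]; apply.
by move: Dm; rewrite mE; exact: order_idealD.
Qed.

HB.instance Definition _ := isIdealr.Build R monomial_ideal monomial_ideal_closed.

Definition monomial_idealr : idealr R := monomial_ideal.

Lemma bigraded_monomial_ideal : bigraded monomial_idealr.
Proof.
exists (fun g => exists2 m, ~~ D m & g = 'X_[m] :> R).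
  move=> _ [m _ ->]; exists (bidegree m).1, (bidegree m).2.
  exact/bihomogX/surjective_pairing.
move=> p; split=> [/hasPn Ip|[s sG ->]].
  exists [seq ((p@_m)%:MP, 'X_[m] : R) | m <- msupp p].
    by move=> _ /mapP[m p_m ->]; exists m; rewrite ?Ip.
  rewrite big_map {1}[p]mpolyE; apply: eq_bigr => m _.
  by rewrite mul_mpolyC.
rewrite big_seq; apply: rpred_sum => c /sG[m nDm ->]; apply: idealMr.
by rewrite inE msuppX /= orbF.
Qed.

Lemma standard_monomial_ideal : standard monomial_idealr =1 D.
Proof.
move=> m; apply/idP/idP => [|Dm].
  apply: contraTT => nDm; rewrite negbK; apply/asboolP.
  exists 'X_[m]; rewrite mpolyX_neq0 mleadXm inE msuppX /= orbF.
  by split=> //; exact/bihomogX/surjective_pairing.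
apply/asboolPn => -[p [/hasPn Ip _ p_neq0 lead_p]].
by have := Ip _ (mlead_supp p_neq0); rewrite lead_p Dm.
Qed.

End MonomialIdeal.

End Hilbert.

Theorem theorem4p10 (k : fieldType)
    (k_infinite : infinite_set [set: k]%classic) (H : nat -> nat -> nat) :
  ferrers_function H <->
  exists2 I : idealr {mpoly k[4]}, bigraded I & H = hilbert_function I.
Proof.
rewrite ferrers_order_ideal; split=> [[D D_ideal HE]|[I _ ->]].
  exists (monomial_idealr k D_ideal); first exact: bigraded_monomial_ideal.
  apply/funext => i; apply/funext => j.
  by rewrite HE hilbert_function_standard (eq_count (standard_monomial_ideal k D_ideal)).
by exists (standard I) => [|i j]; [exact: standard_ideal|exact: hilbert_function_standard].
Qed.
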